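(* Let $K$ be a field and let $\Gamma$ be a group with $\Gamma\simeq\mathbb{Z}^n$, where $n\geq 2$. Then the group algebra $K\Gamma$ has only one end.
   Context: For a unital $K$-algebra $\mathcal{A}$, a $K$-linear subspace $V\subset\mathcal{A}$ is almost invariant if for every $x\in\mathcal{A}$ the quotient $(Vx+V)/V$ is finite dimensional over $K$. $\mathcal{A}$ has $k$ ends if $\mathcal{A}=V_1\oplus\dots\oplus V_k$ with all $V_i$ infinite dimensional almost invariant subspaces, but $\mathcal{A}$ cannot be written as the direct sum of $k+1$ infinite dimensional almost invariant subspaces. *)

(* Defs.v *)
From HB Require Import structures.
From mathcomp Require Import all_boot all_order all_algebra finmap.
From mathcomp Require Import boolp classical_sets.
From mathcomp Require Import monalg.

Set Implicit Arguments.
Unset Strict Implicit.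
Unset Printing Implicit Defensive.

Import GRing.Theory.

Local Open Scope classical_set_scope.
Local Open Scope ring_scope.

(* Multinomials puts a ring structure on {malg K[M]} only when the monoid M has
   no nontrivial units, so the group algebra is an alias of the module
   {malg K[G]} of finitely supported functions G -> K, with its own product. *)
Definition group_algebra (K : comNzRingType) (G : groupType) : Type :=
  {malg K[G]}.

Section GroupAlgebra.
Context (K : comNzRingType) (G : groupType).
Local Open Scope fset_scope.

Implicit Types g : {malg K[G]}.

Definition ga_one : {malg K[G]} := << 1%g >>.

Definition ga_mul g1 g2 : {malg K[G]} :=
  \sum_(x <- msupp g1) \sum_(y <- msupp g2) << g1@_x * g2@_y *g (x * y)%g >>.

Lemma ga_mulw (d1 d2 : {fset G}) g1 g2 :
  msupp g1 `<=` d1 -> msupp g2 `<=` d2 ->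
  ga_mul g1 g2 =
    \sum_(x <- d1) \sum_(y <- d2) << g1@_x * g2@_y *g (x * y)%g >>.
Proof.
move=> le1 le2; rewrite /ga_mul (big_fset_incl _ le1) /=.
  apply/eq_bigr=> x _; apply/big_fset_incl => // y _ /mcoeff_outdom ->.
  by rewrite mulr0 monalgU0.
move=> x _ /mcoeff_outdom g1x.
by rewrite big1 // => y _; rewrite g1x mul0r monalgU0.
Qed.

Lemma ga_mul0g : left_zero 0 ga_mul.
Proof. by move=> g; rewrite /ga_mul msupp0 big_seq_fset0. Qed.

Lemma ga_mulg0 : right_zero 0 ga_mul.
Proof.
by move=> g; rewrite /ga_mul big1 // => x _; rewrite msupp0 big_seq_fset0.
Qed.

Lemma ga_mulUU a b x y :
  ga_mul << a *g x >> << b *g y >> = << a * b *g (x * y)%g >>.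
Proof. by rewrite (ga_mulw msuppU_le msuppU_le) !big_seq_fset1 !mcoeffUU. Qed.

Lemma ga_mulDl : left_distributive ga_mul +%R.
Proof.
move=> g1 g2 g.
rewrite [in RHS](ga_mulw (fsubsetUl _ (msupp g2)) (fsubset_refl _)).
rewrite [in RHS](ga_mulw (fsubsetUr (msupp g1) _) (fsubset_refl _)).
rewrite (ga_mulw (msuppD_le _ _) (fsubset_refl _)).
rewrite -big_split /=; apply/eq_bigr=> x _.
rewrite -big_split /=; apply/eq_bigr=> y _.
by rewrite mcoeffD mulrDl monalgUD.
Qed.

Lemma ga_mulDr : right_distributive ga_mul +%R.
Proof.
move=> g g1 g2.
rewrite [in RHS](ga_mulw (fsubset_refl _) (fsubsetUl _ (msupp g2))).
rewrite [in RHS](ga_mulw (fsubset_refl _) (fsubsetUr (msupp g1) _)).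
rewrite (ga_mulw (fsubset_refl _) (msuppD_le _ _)).
rewrite -big_split /=; apply/eq_bigr=> x _.
rewrite -big_split /=; apply/eq_bigr=> y _.
by rewrite mcoeffD mulrDr monalgUD.
Qed.

Lemma ga_mul_suml I (r : seq I) (F : I -> {malg K[G]}) g :
  ga_mul (\sum_(i <- r) F i) g = \sum_(i <- r) ga_mul (F i) g.
Proof.
exact: (big_morph (ga_mul^~ g) (fun _ _ => ga_mulDl _ _ _) (ga_mul0g _)).
Qed.

Lemma ga_mul_sumr I (r : seq I) (F : I -> {malg K[G]}) g :
  ga_mul g (\sum_(i <- r) F i) = \sum_(i <- r) ga_mul g (F i).
Proof.
exact: (big_morph (ga_mul g) (fun _ _ => ga_mulDr _ _ _) (ga_mulg0 _)).
Qed.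

Lemma ga_mul1g : left_id ga_one ga_mul.
Proof.
move=> g; rewrite [in LHS](monalgE g) ga_mul_sumr [RHS]monalgE.
by apply/eq_bigr=> x _; rewrite ga_mulUU mul1r mul1g.
Qed.

Lemma ga_mulg1 : right_id ga_one ga_mul.
Proof.
move=> g; rewrite [in LHS](monalgE g) ga_mul_suml [RHS]monalgE.
by apply/eq_bigr=> x _; rewrite ga_mulUU mulr1 mulg1.
Qed.

Lemma ga_mulA : associative ga_mul.
Proof.
move=> g1 g2 g3; rewrite (monalgE g1) !ga_mul_suml.
apply/eq_bigr=> x _; rewrite (monalgE g2) ga_mul_sumr !ga_mul_suml ga_mul_sumr.
apply/eq_bigr=> y _; rewrite (monalgE g3) !ga_mul_sumr.
by apply/eq_bigr=> z _; rewrite !ga_mulUU mulrA mulgA.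
Qed.

Lemma ga_one_neq0 : ga_one != 0.
Proof. by rewrite /ga_one monalgU_eq0 oner_eq0. Qed.

Lemma ga_scaleU a b x : a *: << b *g x >> = << a * b *g x >> :> {malg K[G]}.
Proof. by apply/malgP => y; rewrite mcoeffZ !mcoeffU mulrnAr. Qed.

Lemma ga_scaleAl a g1 g2 : a *: ga_mul g1 g2 = ga_mul (a *: g1) g2.
Proof.
rewrite (monalgE g1) ga_mul_suml !scaler_sumr ga_mul_suml.
apply/eq_bigr=> x _; rewrite (monalgE g2) !ga_mul_sumr scaler_sumr.
by apply/eq_bigr=> y _; rewrite ga_scaleU !ga_mulUU ga_scaleU mulrA.
Qed.

Lemma ga_scaleAr a g1 g2 : a *: ga_mul g1 g2 = ga_mul g1 (a *: g2).
Proof.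
rewrite (monalgE g2) ga_mul_sumr !scaler_sumr ga_mul_sumr.
apply/eq_bigr=> x _; rewrite (monalgE g1) !ga_mul_suml scaler_sumr.
by apply/eq_bigr=> y _; rewrite ga_scaleU !ga_mulUU ga_scaleU mulrCA.
Qed.

HB.instance Definition _ := GRing.Lmodule.copy (group_algebra K G) {malg K[G]}.
HB.instance Definition _ := GRing.Zmodule_isNzRing.Build (group_algebra K G)
  ga_mulA ga_mul1g ga_mulg1 ga_mulDl ga_mulDr ga_one_neq0.
HB.instance Definition _ :=
  GRing.Lmodule_isLalgebra.Build K (group_algebra K G) ga_scaleAl.
HB.instance Definition _ :=
  GRing.Lalgebra_isAlgebra.Build K (group_algebra K G) ga_scaleAr.

End GroupAlgebra.

Section Ends.
Context (K : fieldType) (A : algType K).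

Definition subspace (V : set A) : Prop := GRing.submod_closed [in V].

(* For subspaces V `<=` W: the vector space W / V is finite dimensional, i.e.
   spanned by the classes of finitely many elements e_0, ..., e_(m-1) of W. *)
Definition findim_quotient (W V : set A) : Prop :=
  exists (m : nat) (e : 'I_m -> A), (forall i, W (e i)) /\
    forall w, W w -> exists c : 'I_m -> K, V (w - \sum_(i < m) c i *: e i).

Definition findim (V : set A) : Prop := findim_quotient V [set 0].

Definition almost_invariant (V : set A) : Prop :=
  subspace V /\
  forall x : A, findim_quotient [set v * x + w | v in V & w in V] V.

Definition direct_sum_decomposition (k : nat) (V : 'I_k -> set A) : Prop :=
  forall a : A, exists! v : {ffun 'I_k -> A},
    (forall i, V i (v i)) /\ a = \sum_(i < k) v i.

Definition splits_into (k : nat) : Prop :=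
  exists V : 'I_k -> set A,
    (forall i, almost_invariant (V i) /\ ~ findim (V i)) /\
    direct_sum_decomposition V.

Definition has_ends (k : nat) : Prop := splits_into k /\ ~ splits_into k.+1.

End Ends.

(* Main.v *)
(** The projection P of A = K[Z^n] onto the first of two complementary almost
    invariant subspaces commutes with multiplication by each group element up
    to an operator whose image lies in K^T for some finite T in Z^n.  For the
    basis translations this says that, for each fixed g, the coefficient of
    P(h) at h + g is locally constant in h + g off a finite set not depending
    on g.  As Z^n has one end for n >= 2, it is a constant c_g off a box not
    depending on g; taking h = 0 shows that c has finite support.  Hence P is
    multiplication by f = sum c_g g up to an operator with image in some K^T.
    From P^2 = P one gets f^2 = f, so f is 0 or 1, and one of the two subspaces
    lies in K^T. *)

Require Import Defs.
From mathcomp Require Import all_boot all_order all_algebra.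
From mathcomp Require Import finmap boolp classical_sets monalg zify ring lra.

Set Implicit Arguments.
Unset Strict Implicit.
Unset Printing Implicit Defensive.

Import Order.TTheory GRing.Theory Num.Theory.

Local Open Scope ring_scope.

(** * One-endedness and Euclidean geometry of the lattice [Z^n] *)

Section Lattice.
Variable n : nat.
Implicit Types k : 'rV[int]_n.

Definition outside (R : nat) k := [exists i, (R < `|k 0%R i|)%N].

Definition set_coord (j : 'I_n) (a : int) k : 'rV[int]_n :=
  \row_l (if l == j then a else k 0 l).

Lemma set_coordE j a k :
  set_coord j a k = k + (a - k 0 j) *: delta_mx 0 j.
Proof.
apply/rowP => l; rewrite !mxE eqxx /=; case: eqP => [->|_].
  by rewrite mulr1 addrC subrK.
by rewrite mulr0 addr0.
Qed.

Section OneEnded.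
Variables (R : nat) (T : Type) (F : 'rV[int]_n -> T).
Hypothesis stepF : forall k i, outside R k -> F (k + delta_mx 0 i) = F k.

(** A move along axis [j] leaves coordinate [i] untouched, and that coordinate alone keeps every
    point of the line outside the box, so [stepF] applies at each of them. *)
Lemma line_const k i j (a : int) :
  i != j -> (R < `|k 0%R i|)%N -> F (k + a *: delta_mx 0 j) = F k.
Proof.
move=> ij.
have nat_line k' (m : nat) : (R < `|k' 0%R i|)%N ->
    F (k' + m%:Z *: delta_mx 0 j) = F k'.
  move=> ki; elim: m => [|m IH]; first by rewrite scale0r addr0.
  rewrite (_ : m.+1%:Z = m%:Z + 1) ?scalerDl ?scale1r ?addrA ?stepF //; last lia.
  apply/existsP; exists i.
  by rewrite !mxE (negbTE ij) andbF mulr0 addr0.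
move=> ki; case: a => m; first exact: nat_line.
(* A negative move is read backwards: [k] is reached from the far end by positive unit steps. *)
rewrite -[in RHS](subrK (m.+1%:Z *: delta_mx 0 j) k) nat_line.
  by rewrite NegzE scaleNr.
by rewrite !mxE (negbTE ij) andbF mulr0 subr0.
Qed.

Lemma set_coord_const k i j a :
  i != j -> (R < `|k 0%R i|)%N -> F (set_coord j a k) = F k.
Proof. by move=> ij ki; rewrite set_coordE (line_const _ ij). Qed.

(** Two axes suffice to walk around the box. Coordinate [i] is large, so coordinate [j] may be
    raised to [R + 1]. From then on all coordinates are overwritten one at a time, and at each move
    one of [i], [j] stays fixed and large. *)
Lemma one_ended k : (2 <= n)%N -> outside R k -> F k = F (const_mx R.+1%:Z).
Proof.
move=> n2 /existsP[i ki].
have [j ij] : exists j : 'I_n, i != j.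
  have n1 : (1 < n)%N by [].
  case: (eqVneq i (Ordinal n1)) => [->|]; last by exists (Ordinal n1).
  by exists (Ordinal (ltnW n1)).
rewrite -(set_coord_const R.+1%:Z ij ki).
pose fill s k' := foldr (fun l => set_coord l R.+1%:Z) k' s.
have fillE s k' l : fill s k' 0 l = if l \in s then R.+1%:Z else k' 0 l.
  elim: s => //= m s IH; rewrite mxE inE IH.
  by case: eqP.
have fill_const s k' : (R < `|k' 0%R i|)%N -> (R < `|k' 0%R j|)%N ->
    F (fill s k') = F k'.
  move=> k'i k'j; elim: s => //= m s <-.
  have [im|im] := eqVneq i m.
    apply: (@set_coord_const _ j); first by rewrite -im eq_sym.
    by rewrite fillE; case: ifP.
  apply: (@set_coord_const _ i) => //.
  by rewrite fillE; case: ifP.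
rewrite -(fill_const (enum 'I_n)); last 2 first.
- by rewrite mxE (negbTE ij).
- by rewrite mxE eqxx.
- by congr F; apply/rowP => l; rewrite fillE mem_enum [in RHS]mxE.
Qed.

End OneEnded.

Lemma finite_box R : exists s : seq 'rV[int]_n, forall k, ~~ outside R k -> k \in s.
Proof.
(* Shifting by [R] turns the coordinates of the box into naturals from [0] to [2R]. *)
exists [seq \row_i ((f i : nat)%:Z - R%:Z) | f : {ffun 'I_n -> 'I_(R + R).+1}].
move=> k /existsPn out; apply/fintype.imageP.
exists [ffun i => inord `|k 0%R i + R%:Z|] => //.
apply/rowP => i; rewrite mxE ffunE.
have := out i; rewrite -leqNgt; move: (k 0 i) => z zR.
rewrite inordK; lia.
Qed.

Lemma bounded_seq (s : seq 'rV[int]_n) :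
  exists R, forall k, k \in s -> ~~ outside R k.
Proof.
exists (\max_(k <- s) \max_i `|k 0%R i|)%N => k ks.
apply/existsPn => i; rewrite -leqNgt.
apply: leq_trans (leq_bigmax_seq _ ks isT).
exact: (leq_bigmax i).
Qed.

Definition sqnorm k : int := \sum_i k 0 i ^+ 2.

Lemma sqnorm_eq0 k : sqnorm k <= 0 -> k = 0.
Proof.
move=> k0.
have /eqP := le_anti (introT andP (conj k0 (sumr_ge0 _ (fun i _ => sqr_ge0 (k 0 i))))).
rewrite psumr_eq0 => [/allP k00|i _]; last exact: sqr_ge0.
apply/rowP => i; rewrite mxE; apply/eqP.
by have := k00 i (mem_index_enum i); rewrite sqrf_eq0.
Qed.

(* By the parallelogram law, [s] is an extreme point of the ball through it. *)
Lemma sqnorm_extreme (s a b : 'rV[int]_n) :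
  sqnorm a <= sqnorm s -> sqnorm b <= sqnorm s -> a + b = s + s -> a = s.
Proof.
move=> la lb e.
have eab : sqnorm (a - s) *+ 2 = sqnorm a + sqnorm b - sqnorm s *+ 2.
  rewrite /sqnorm -!sumrMnl -!big_split /= -sumrB; apply: eq_bigr => i _.
  have -> : b = s + s - a by rewrite -e addrC addKr.
  by rewrite !mxE; ring.
apply/eqP; rewrite -subr_eq0; apply/eqP/sqnorm_eq0; lra.
Qed.

Lemma sqnormD s : sqnorm (s + s) = sqnorm s *+ 4.
Proof. by rewrite /sqnorm -sumrMnl; apply: eq_bigr => i _; rewrite mxE; ring. Qed.

End Lattice.

(** * Coefficients and finite supports in a group algebra *)

Section GroupAlgebraSupport.
Variables (K : fieldType) (G : groupType).
Local Notation A := (group_algebra K G).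
Implicit Types (a b : A) (g h x : G) (T : seq G) (V : set A).

Definition ga_delta g : A := << g >>.
Local Notation delta := ga_delta.

Lemma coefD a b g : (a + b)@_g = a@_g + b@_g. Proof. exact: mcoeffD. Qed.
Lemma coefB a b g : (a - b)@_g = a@_g - b@_g. Proof. exact: mcoeffB. Qed.
Lemma coefN a g : (- a)@_g = - a@_g. Proof. exact: mcoeffN. Qed.
Lemma coefZ (c : K) a g : (c *: a)@_g = c * a@_g. Proof. exact: mcoeffZ. Qed.
Lemma coef0 g : (0 : A)@_g = 0. Proof. exact: mcoeff0. Qed.
Lemma coef_delta h g : (delta h)@_g = (h == g)%:R. Proof. exact: mcoeffU. Qed.

Lemma coef_sum I (r : seq I) (E : I -> A) g :
  (\sum_(i <- r) E i)@_g = \sum_(i <- r) (E i)@_g.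
Proof. by apply: (big_morph (mcoeff g)) => [a b|]; rewrite (coefD, coef0). Qed.

Lemma deltaM g h : delta g * delta h = delta (g * h)%g.
Proof. by have := ga_mulUU (1 : K) 1 g h; rewrite mulr1. Qed.

Lemma delta1 : delta 1%g = 1. Proof. by []. Qed.

Lemma coefM a b g : (a * b)@_g =
  \sum_(x <- msupp a) \sum_(y <- msupp b) (a@_x * b@_y) *+ ((x * y)%g == g).
Proof.
rewrite [a * b]/(ga_mul _ _) coef_sum; apply: eq_bigr => x _.
by rewrite coef_sum; apply: eq_bigr => y _; exact: mcoeffU.
Qed.

Lemma ga_ind (Pr : A -> Prop) :
    Pr 0 -> (forall a b, Pr a -> Pr b -> Pr (a + b)) ->
    (forall (c : K) h, Pr (c *: delta h)) ->
  forall a, Pr a.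
Proof.
move=> Pr0 PrD PrU a; rewrite [a]monalgE; apply: (big_ind Pr) => // h _.
by have := PrU a@_h h; rewrite [_ *: _]ga_scaleU mulr1.
Qed.

Lemma coef_deltal h a g : (delta h * a)@_(h * g)%g = a@_g.
Proof.
elim/ga_ind: a => [|a b IHa IHb|c x]; first by rewrite mulr0 !coef0.
  by rewrite mulrDr !coefD IHa IHb.
by rewrite -scalerAr deltaM !coefZ !coef_delta (inj_eq (mulgI h)).
Qed.

Lemma coef_deltar h a g : (a * delta h)@_(g * h)%g = a@_g.
Proof.
elim/ga_ind: a => [|a b IHa IHb|c x]; first by rewrite mul0r !coef0.
  by rewrite mulrDl !coefD IHa IHb.
by rewrite -scalerAl deltaM !coefZ !coef_delta (inj_eq (mulIg h)).
Qed.

(** Membership in [K^T], which is finite dimensional because [T] is a list. Placing [T] before a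
    universal quantifier over [a] expresses a uniform bound. *)
Definition supported T a := forall g, g \notin T -> a@_g = 0.

Lemma supported_msupp a : supported (msupp a) a.
Proof. by move=> g; exact: mcoeff_outdom. Qed.

Lemma sub_supported T1 T2 a :
  {subset T1 <= T2} -> supported T1 a -> supported T2 a.
Proof. by move=> sT aT g gT; apply: aT; apply: contra gT => /sT. Qed.

Lemma supported0 T : supported T 0.
Proof. by move=> g _; exact: coef0. Qed.

Lemma supportedD T a b : supported T a -> supported T b -> supported T (a + b).
Proof. by move=> aT bT g gT; rewrite coefD aT // bT // addr0. Qed.

Lemma supportedN T a : supported T a -> supported T (- a).
Proof. by move=> aT g gT; rewrite coefN aT // oppr0. Qed.

Lemma supportedB T a b : supported T a -> supported T b -> supported T (a - b).
Proof. by move=> aT bT; apply: supportedD => //; exact: supportedN. Qed.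

Lemma supportedZ T (c : K) a : supported T a -> supported T (c *: a).
Proof. by move=> aT g gT; rewrite coefZ aT // mulr0. Qed.

Lemma supported_sum T I (r : seq I) (E : I -> A) :
  (forall i, supported T (E i)) -> supported T (\sum_(i <- r) E i).
Proof.
move=> ET; apply: (big_ind (supported T)) => //; first exact: supported0.
by move=> a b; exact: supportedD.
Qed.

Lemma supportedM T a b : supported T a ->
  supported [seq (x * y)%g | x <- T, y <- msupp b] (a * b).
Proof.
move=> aT g gT; rewrite coefM big_seq big1 // => x xa; rewrite big_seq big1 //.
move=> y yb; case: eqP => // e; case/negP: gT.
apply/allpairsP; exists (x, y); split => //=.
by apply: contraLR xa => /aT; rewrite -mcoeff_eq0 => ->.
Qed.

Lemma common_support (I : finType) (Pr : I -> seq G -> Prop) :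
    (forall i T1 T2, {subset T1 <= T2} -> Pr i T1 -> Pr i T2) ->
    (forall i, exists T, Pr i T) ->
  exists T, forall i, Pr i T.
Proof.
move=> mono /choice[T PrT]; exists (flatten [seq T i | i : I]) => i.
apply: (mono i (T i)) => // x xT; apply/flattenP.
by exists (T i) => //; exact: fintype.image_f.
Qed.

Lemma family_supported m (e : 'I_m -> A) : exists T, forall i, supported T (e i).
Proof.
apply: common_support => [i|i]; first exact: (fun T1 T2 => @sub_supported T1 T2 _).
by exists (msupp (e i)); exact: supported_msupp.
Qed.

Lemma subspaceP V :
  subspace V <-> V 0 /\ forall (c : K) a b, V a -> V b -> V (c *: a + b).
Proof.
split=> [[V0 Vl]|[V0 Vl]].
  split=> [|c a b Va Vb]; first by move: V0; rewrite inE.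
  by have := Vl c a b; rewrite !inE; apply.
by split=> [|c a b]; rewrite !inE //; exact: Vl.
Qed.

Lemma supported_findim T V :
  subspace V -> (forall a, V a -> supported T a) -> findim V.
Proof.
elim: T V => [|t T IH] V /subspaceP[V0 Vl] VT.
  exists 0%N, (fun=> 0); split=> // w Vw; exists (fun=> 0).
  rewrite big_ord0 subr0; apply/malgP => g.
  by rewrite (VT w Vw g) // mcoeff0.
have [[v [Vv vt]]|nov] := pselect (exists v, V v /\ v@_t != 0); last first.
  apply: IH; first exact/subspaceP.
  move=> a Va g gT; have [->|gt] := eqVneq g t.
    by apply/eqP/negP => /negP at0; apply: nov; exists a.
  by apply: (VT a Va); rewrite inE negb_or gt.
have [||m [e [Ve span]]] := IH [set a | V a /\ a@_t = 0]%classic.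
- apply/subspaceP; split; first by split=> //; exact: coef0.
  move=> c a b [Va at0] [Vb bt0]; split; first exact: Vl.
  by rewrite coefD coefZ at0 bt0 mulr0 addr0.
- move=> a [Va at0] g gT; have [->//|gt] := eqVneq g t.
  by apply: (VT a Va); rewrite inE negb_or gt.
exists m.+1, (fun i => if unlift ord0 i is Some j then e j else v).
split=> [i|w Vw]; first by case: unlift => [j|//]; case: (Ve j).
have [] := span (- (w@_t / v@_t) *: v + w).
  by split; [exact: Vl | rewrite coefD coefZ mulNr divfK // addNr].
move=> c wE.
exists (fun i => if unlift ord0 i is Some j then c j else w@_t / v@_t).
rewrite big_ord_recl unlift_none /=.
under eq_bigr do rewrite liftK.
by rewrite opprD addrA -[RHS]wE scaleNr [- _ + w]addrC.
Qed.

(** * Projections onto complementary almost invariant subspaces *)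

Section Projections.
Variables (V W : set A) (P Q : A -> A).
Hypotheses (subV : subspace V) (subW : subspace W).
Hypothesis PQ : forall a, [/\ V (P a), W (Q a) & P a + Q a = a].
Hypothesis PQuniq : forall a b, V a -> W b -> P (a + b) = a /\ Q (a + b) = b.

Lemma proj_linear (c : K) a b :
  P (c *: a + b) = c *: P a + P b /\ Q (c *: a + b) = c *: Q a + Q b.
Proof.
have [_ Vl] := (subspaceP V).1 subV; have [_ Wl] := (subspaceP W).1 subW.
have [[VPa WQa aE] [VPb WQb bE]] := (PQ a, PQ b).
have -> : c *: a + b = (c *: P a + P b) + (c *: Q a + Q b).
  by rewrite addrACA -scalerDr aE bE.
by apply: PQuniq; [exact: Vl | exact: Wl].
Qed.

Lemma proj_id a : V a -> P a = a /\ Q a = 0.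
Proof.
have [W0 _] := (subspaceP W).1 subW.
by move=> Va; rewrite -{1 3}[a]addr0; exact: PQuniq.
Qed.

Lemma projrD a b : Q (a + b) = Q a + Q b.
Proof. by have [_] := proj_linear 1 a b; rewrite !scale1r. Qed.

Lemma projr0 : Q 0 = 0.
Proof. by have [V0 _] := (subspaceP V).1 subV; have [_] := proj_id V0. Qed.

Lemma projrZ (c : K) a : Q (c *: a) = c *: Q a.
Proof. by have [_] := proj_linear c a 0; rewrite !addr0 projr0 addr0. Qed.

(** Modulo [V], each [v * x] is a combination of finitely many [e i]. As [Q] kills [V], a common
    support of the [Q (e i)] serves for all [v] at once. *)
Lemma almost_invariant_defect (x : A) : almost_invariant V ->
  exists T, forall v, V v -> supported T (Q (v * x)).
Proof.
case=> _ /(_ x)[m [e [_ span]]].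
have [T eT] := family_supported (Q \o e).
exists T => v Vv.
have [V0 _] := (subspaceP V).1 subV.
have [|c Vc] := span (v * x).
  by exists v => //; exists 0 => //; rewrite addr0.
rewrite -(subrK (\sum_(i < m) c i *: e i) (v * x)) projrD.
have [_ ->] := proj_id Vc; rewrite add0r.
rewrite (big_morph Q projrD projr0); apply: supported_sum => i.
by rewrite projrZ; apply: supportedZ; exact: eT.
Qed.

End Projections.

Lemma proj_commutator V W (P Q : A -> A) :
    almost_invariant V -> almost_invariant W ->
    (forall a, [/\ V (P a), W (Q a) & P a + Q a = a]) ->
    (forall a b, V a -> W b -> P (a + b) = a /\ Q (a + b) = b) ->
  forall x : A, exists T, forall a, supported T (P (a * x) - P a * x).
Proof.
move=> aiV aiW PQ PQu x.
have [subV subW] := (aiV.1, aiW.1).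
have QP a : [/\ W (Q a), V (P a) & Q a + P a = a].
  by have [? ? ?] := PQ a; split=> //; rewrite addrC.
have QPu a b : W a -> V b -> Q (a + b) = a /\ P (a + b) = b.
  by move=> Wa Vb; rewrite addrC; have [] := PQu b a Vb Wa.
have [T QT] := almost_invariant_defect subV subW PQ PQu x aiV.
have [T' PT] := almost_invariant_defect subW subV QP QPu x aiW.
exists (T ++ T') => a; have [VPa WQa aE] := PQ a.
(* Splitting [a] as [P a + Q a] leaves only the two cross terms, one controlled by almost invariance
   of [W], the other by that of [V]. *)
have -> : P (a * x) - P a * x = P (Q a * x) - Q (P a * x).
  rewrite -{1}aE mulrDl (projrD subW subV QP QPu) addrAC addrC; congr (_ + _).
  by have [_ _ {2}<-] := PQ (P a * x); rewrite opprD addNKr.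
apply: supportedB.
  by apply: sub_supported (PT _ WQa) => t; rewrite mem_cat orbC => ->.
by apply: sub_supported (QT _ VPa) => t; rewrite mem_cat => ->.
Qed.

Lemma decomposition2 (V : 'I_2 -> set A) : direct_sum_decomposition V ->
  exists P Q : A -> A,
    (forall a, [/\ V ord0 (P a), V ord_max (Q a) & P a + Q a = a]) /\
    (forall a b, V ord0 a -> V ord_max b -> P (a + b) = a /\ Q (a + b) = b).
Proof.
move=> /choice[v vP].
exists (fun a => v a ord0), (fun a => v a ord_max); split=> [a|a b Va Wb].
  have [[Vv aE] _] := vP a; split=> //.
  by rewrite [RHS]aE big_ord_recr big_ord1 /=; congr (v a _ + _); exact/val_inj.
have [_ uniq] := vP (a + b).
rewrite (uniq [ffun i => if i == ord0 then a else b]) ?ffunE //.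
split=> [i|]; last first.
  by rewrite big_ord_recr big_ord1 !ffunE.
rewrite ffunE; case: (eqVneq i ord0) => [->//|i0].
by have -> : i = ord_max by apply/val_inj; case: i i0 => [[|[]]].
Qed.

(** * The group algebra of [Z^n]: approximating [P] by a multiplication, and idempotents *)

Section FreeAbelian.
Variables (n : nat) (phi : G -> 'rV[int]_n) (psi : 'rV[int]_n -> G).
Hypotheses (n2 : (2 <= n)%N) (phiK : cancel phi psi) (psiK : cancel psi phi).
Hypothesis phiM : forall x y, phi (x * y)%g = phi x + phi y.

Lemma phi1 : phi 1%g = 0.
Proof. by apply: (@addIr _ (phi 1%g)); rewrite -phiM mulg1 add0r. Qed.

Lemma psiD u v : psi (u + v) = (psi u * psi v)%g.
Proof. by rewrite -[RHS]phiK phiM !psiK. Qed.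

Lemma exists_notin T : exists g, g \notin T.
Proof.
have [R sR] := bounded_seq (map phi T).
exists (psi (const_mx R.+1%:Z)); apply/negP => /(map_f phi)/sR.
rewrite psiK => /negP; apply.
by apply/existsP; exists (Ordinal (ltnW n2)); rewrite mxE.
Qed.

(** The group is infinite, so a point of the support of [a] could be translated out of [T]. *)
Lemma supported_delta_mul T a : (forall h, supported T (delta h * a)) -> a = 0.
Proof.
move=> aT; apply/malgP => s; rewrite mcoeff0; apply/eqP/negP => /negP as0.
have [g gT] := exists_notin T.
have := aT (g * s^-1)%g (g * s^-1 * s)%g.
by rewrite coef_deltal mulgVK => /(_ gT); exact/eqP.
Qed.

Lemma almost_commuting (P : A -> A) :
    (forall (c : K) a b, P (c *: a + b) = c *: P a + P b) ->
    (forall x : A, exists T, forall a, supported T (P (a * x) - P a * x)) ->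
  exists (f : A) T, forall a, supported T (P a - a * f).
Proof.
move=> Plin Pcom.
have P0 : P 0 = 0.
  by have := Plin (-1) 0 0; rewrite scaler0 addr0 scaleN1r addNr.
pose e i : 'rV[int]_n := delta_mx 0 i.
have [T0 T0P] : exists T, forall (i : 'I_n) a,
    supported T (P (a * delta (psi (e i))) - P a * delta (psi (e i))).
  apply: common_support => [i T1 T2 s12 H a|i]; last exact: Pcom.
  exact: sub_supported (H a).
(* The box contains every [t - e i], so a unit step from a point outside it cannot land in [T0]. *)
have [R T0R] := bounded_seq [seq phi t - e i | t <- T0, i <- enum 'I_n].
(* Parametrised by the endpoint [v = h + g]: [F g v] is the coefficient of [P h] at [v]. The box
   found above serves for all [g]. *)
pose F g v := (P (delta (psi (v - phi g))))@_(psi v).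
have stepF g v i : outside R v -> F g (v + e i) = F g v.
  move=> vR; rewrite /F addrAC !psiD -deltaM.
  have := T0P i (delta (psi v * psi (- phi g))%g) (psi v * psi (e i))%g.
  rewrite coefB coef_deltar => /(_ _)/eqP; rewrite subr_eq0 => H; apply/eqP/H.
  apply: contraL vR => vT; apply: T0R.
  apply/allpairsP; exists (psi v * psi (e i), i)%g.
  by split=> //=; [rewrite mem_enum | rewrite phiM !psiK addrK].
pose c g := F g (const_mx R.+1%:Z).
have Pc h k : outside R (phi k) -> (P (delta h))@_k = c (h^-1 * k)%g.
  move=> kR; rewrite /c -(one_ended (stepF _) n2 kR) /F !phiK phiM opprD addrCA.
  have -> : phi h^-1 = - phi h.
    by apply/eqP; rewrite -addr_eq0 -phiM mulVg phi1.
  by rewrite opprK subrr addr0 phiK.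
have [B RB] := finite_box n R.
pose T := map psi B.
have outT k : k \notin T -> outside R (phi k).
  by apply: contraR => /RB/(map_f psi); rewrite phiK.
(* Off the box, [c g] is the coefficient of [P 1] at [g], so [c] vanishes outside [S] and [f] has
   all the [c g] as its coefficients. *)
pose S := undup (T ++ msupp (P 1)).
pose f : A := \sum_(g <- S) c g *: delta g.
have fE g : f@_g = c g.
  rewrite /f coef_sum; have [gS|gS] := boolP (g \in S).
    rewrite (bigD1_seq g) ?undup_uniq //= coefZ coef_delta eqxx mulr1.
    rewrite big1 ?addr0 // => h hg.
    by rewrite coefZ coef_delta (negbTE hg) mulr0.
  rewrite big_seq big1 => [|h hS]; last first.
    rewrite coefZ coef_delta; case: eqP => [hg|]; last by rewrite mulr0.
    by rewrite -hg hS in gS.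
  move: gS; rewrite mem_undup mem_cat negb_or => /andP[/outT gR gP].
  by rewrite -[g]mul1g -{1}invg1 -Pc // delta1 mcoeff_outdom.
exists f, T; elim/ga_ind=> [|a b IHa IHb|d h].
- by rewrite P0 mul0r subr0; exact: supported0.
- have := Plin 1 a b; rewrite !scale1r => ->.
  by rewrite mulrDl opprD addrACA; exact: supportedD.
(* On a group element [h], both [P h] and [h * f] have coefficient [c (h^-1 * k)] at any [k] outside
   [T]. *)
have := Plin d (delta h) 0; rewrite P0 !addr0 => ->.
rewrite -scalerAl -scalerBr; apply: supportedZ => k /outT kR.
have := coef_deltal h f (h^-1 * k)%g; rewrite mulVKg => fk.
by rewrite coefB fk fE Pc // subrr.
Qed.

(* If [s] has maximal Euclidean norm in the support of [f], then [s * s] is only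
   obtained as the product [s * s] of support elements, hence lies in the support
   of [f * f = f]; maximality then forces [s = 1]. *)
Lemma idempotent_ga (f : A) : f * f = f -> f = 0 \/ f = 1.
Proof.
move=> ff; have [->|f0] := eqVneq f 0; first by left.
right.
have [s0 s0f] : exists s0, s0 \in msupp f.
  apply: contrapT => nos; case/eqP: f0; apply/malgP => g; rewrite mcoeff0.
  by apply/eqP; rewrite mcoeff_eq0; apply/negP => gf; apply: nos; exists g.
pose q (x : msupp f) := sqnorm (phi (val x)).
have [s sf smax] : exists2 s, s \in msupp f &
    forall x, x \in msupp f -> sqnorm (phi x) <= sqnorm (phi s).
  case: (@arg_maxP _ _ _ (FSetSub s0f) xpredT q isT) => s _ smax.
  exists (val s); first exact: valP.
  by move=> x xf; exact: (smax (FSetSub xf)).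
have fss : f@_(s * s)%g = f@_s ^+ 2.
  rewrite -{1}ff coefM.
  have zero x y : x \in msupp f -> y \in msupp f -> (x != s) || (y != s) ->
      (f@_x * f@_y) *+ ((x * y)%g == (s * s)%g) = 0.
    move=> xf yf; have [/(congr1 phi)|//] := eqVneq (x * y)%g (s * s)%g.
    rewrite !phiM => e.
    have xs : x = s.
      by apply: (can_inj phiK); exact: sqnorm_extreme (smax _ xf) (smax _ yf) e.
    by move: e; rewrite xs => /addrI/(can_inj phiK) ->; rewrite eqxx.
  rewrite (bigD1_seq s) //= (bigD1_seq s) //= eqxx mulr1n -expr2.
  rewrite big_seq_cond big1 ?addr0 => [|y /andP[yf ys]]; last first.
    by rewrite zero ?ys ?orbT.
  rewrite big_seq_cond big1 ?addr0 // => x /andP[xf xs].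
  by rewrite big_seq big1 // => y yf; rewrite zero ?xs.
have s1 : phi s = 0.
  have : (s * s)%g \in msupp f by rewrite -mcoeff_neq0 fss expf_neq0 // mcoeff_neq0.
  by move=> /smax; rewrite phiM sqnormD => le; apply: sqnorm_eq0; lia.
have fsupp x : x \in msupp f -> x = 1%g.
  move=> /smax; rewrite s1 => le; apply: (can_inj phiK); rewrite phi1.
  apply: sqnorm_eq0; apply: le_trans le _.
  by rewrite /sqnorm big1 // => i _; rewrite mxE expr0n.
have fE : f = f@_1%g *: 1.
  apply/malgP => x; rewrite coefZ coef_delta eq_sym.
  have [->|x1] := eqVneq x 1%g; first by rewrite mulr1.
  rewrite mulr0; apply: mcoeff_outdom.
  by apply: contra x1 => /fsupp ->.
(* With [s = 1], [fss] says that the scalar [f@_1] is idempotent, hence [0] or [1] in the field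
   [K]. *)
move: fss; rewrite (fsupp _ sf) mulg1 expr2 => /esym/eqP.
rewrite -subr_eq0 -{3}[f@_1%g]mulr1 -mulrBr mulf_eq0 subr_eq0 => /orP[/eqP e|/eqP e].
  by move: f0; rewrite fE e scale0r eqxx.
by rewrite fE e scale1r.
Qed.

Lemma not_splits2 : ~ splits_into A 2.
Proof.
case=> V [aiV dV]; have [P [Q [PQ PQu]]] := decomposition2 dV.
have [[aiV0 inf0] [aiV1 inf1]] := (aiV ord0, aiV ord_max).
have Plin c a b := (proj_linear aiV0.1 aiV1.1 PQ PQu c a b).1.
have [f [T fT]] := almost_commuting Plin (proj_commutator aiV0 aiV1 PQ PQu).
have PP a : P (P a) = P a.
  by have [VPa _ _] := PQ a; have [] := proj_id aiV1.1 PQu VPa.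
have ff : f - f * f = 0.
  apply: (@supported_delta_mul (T ++ [seq (x * y)%g | x <- T, y <- msupp f])).
  move=> h; set a := delta h.
  (* Only the defect [P b - b * f] occurs on the right, at [b = P a] and [b = a], the last time
     multiplied by [f]. Its support is bounded independently of [h]. *)
  have -> : a * (f - f * f) =
      (P (P a) - P a * f) - (P a - a * f) + (P a - a * f) * f.
    by rewrite PP mulrBr mulrA mulrBl opprB [_ + (_ - P a)]addrC !subrKA.
  apply: supportedD.
    by apply: supportedB; apply: sub_supported (fT _) => x; rewrite mem_cat => ->.
  by apply: sub_supported (supportedM (fT a)) => x; rewrite mem_cat orbC => ->.
have [f0|f1] := idempotent_ga (esym (subr0_eq ff)).
(* If [f = 0], the defect at [a] is [P a], which is [a] itself on the first subspace; if [f = 1], it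
   is [- a] on the second, where [P] vanishes. *)
- apply: inf0; apply: (supported_findim (T := T) aiV0.1) => a Va.
  by have := fT a; rewrite f0 mulr0 subr0 (proj_id aiV1.1 PQu Va).1.
- apply: inf1; apply: (supported_findim (T := T) aiV1.1) => a Wa.
  have [V0 _] := (subspaceP (V ord0)).1 aiV0.1.
  have := fT a; rewrite f1 mulr1 -{1}[a]add0r (PQu _ _ V0 Wa).1 sub0r.
  by move=> /supportedN; rewrite opprK.
Qed.

(** The whole algebra is infinite dimensional: finitely many elements have a common finite support
    [T], and a group element outside [T] is not in their span. *)
Lemma splits1 : splits_into A 1.
Proof.
exists (fun=> setT); split=> [_|a].
  split.
    split; first by apply/subspaceP.
    move=> x; exists 0%N, (fun=> 0); split=> [[]//|w _].
    by exists (fun=> 0).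
  case=> m [e [_ span]].
  have [T eT] := family_supported e.
  have [g gT] := exists_notin T.
  have [c /eqP] := span (delta g) I.
  rewrite subr_eq0 => /eqP/(congr1 (mcoeff g)).
  rewrite coef_delta eqxx => /esym/eqP.
  have -> : (\sum_(i < m) c i *: e i)@_g = 0.
    by apply: (supported_sum _ _ gT) => i; apply: supportedZ; exact: eT.
  by rewrite eq_sym oner_eq0.
exists [ffun=> a]; split; first by split=> //; rewrite big_ord1 ffunE.
by move=> v [_ aE]; apply/ffunP => i; rewrite ffunE aE big_ord1 (ord1 i).
Qed.

End FreeAbelian.
End GroupAlgebraSupport.

Theorem theorem4 (K : fieldType) (Gamma : groupType) (n : nat) (hn : (2 <= n)%N)
  (hGamma : exists f : Gamma -> 'rV[int]_n,
     bijective f /\ forall x y : Gamma, f (x * y)%g = f x + f y) :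
  has_ends (group_algebra K Gamma) 1.
Proof.
have [phi [[psi phiK psiK] phiM]] := hGamma.
split; first exact: splits1 psiK.
exact: not_splits2 phiK psiK phiM.
Qed.
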